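(* Let $D=(E,\mathcal{F})$ be a binary delta-matroid. Then its twist polynomial ${}^\partial w_D(z)=\sum_{A\subseteq E} z^{w(D*A)}$ is either an even polynomial, an odd polynomial, or both even-interpolating and odd-interpolating.
   Context: A set system is a pair $D=(E,\mathcal{F})$ with $E$ a finite set and $\mathcal{F}$ a collection of subsets of $E$ (feasible sets). A delta-matroid is a set system with $\mathcal{F}\neq\emptyset$ satisfying the Symmetric Exchange Axiom: for all $X,Y\in\mathcal{F}$ and $u\in X\Delta Y$ there is $v\in X\Delta Y$ (possibly $v=u$) with $X\Delta\{u,v\}\in\mathcal{F}$, where $\Delta$ is symmetric difference. The twist of $D$ by $A\subseteq E$ is $D*A=(E,\{A\Delta X: X\in\mathcal{F}\})$. For a symmetric matrix $C$ over $\mathrm{GF}(2)$ with rows and columns indexed by $E$, $D(C)=(E,\{A\subseteq E: C[A]\text{ non-singular}\})$, where $C[A]$ is the principal submatrix on $A$ and $C[\emptyset]$ is regarded as non-singular. A delta-matroid is binary if some twist of it is isomorphic to $D(C)$ for some such $C$. The width of a set system is $w(D)=\max\{|F|:F\in\mathcal{F}\}-\min\{|F|:F\in\mathcal{F}\}$. For a polynomial $p(z)=\sum_i c_iz^i$, $p$ has a gap of size $k$ at $c_i$ if $c_{i-1}c_{i+k}\neq0$ and $c_i=\dots=c_{i+k-1}=0$; $p$ is interpolating if it is nonzero and has no gaps. Writing $p(z)=p_e(z^2)+z\,p_o(z^2)$ with $p_e(z^2)$ the even-degree terms and $z\,p_o(z^2)$ the odd-degree terms, $p$ is even-interpolating (resp.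 odd-interpolating) if $p_e(z^2)$ (resp. $p_o(z^2)$) is interpolating. An even (resp. odd) polynomial is one whose only nonzero terms have even (resp. odd) degree. *)

(* Defs.v *)
From HB Require Import structures.
From mathcomp Require Import all_boot all_order all_algebra.
Set Implicit Arguments. Unset Strict Implicit. Unset Printing Implicit Defensive.
Import Order.TTheory GRing.Theory Num.Theory.
Local Open Scope ring_scope.

Definition symdiff (T : finType) (X Y : {set T}) : {set T} := (X :\: Y) :|: (Y :\: X).

Definition is_delta_matroid (E : finType) (F : {set {set E}}) : Prop :=
  F != set0 /\
  forall X Y u, X \in F -> Y \in F -> u \in symdiff X Y ->
    exists2 v, v \in symdiff X Y & symdiff X [set u; v] \in F.

Definition twist (E : finType) (F : {set {set E}}) (A : {set E}) : {set {set E}} :=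
  [set symdiff A X | X in F].

Definition principal_submx (R : Type) (n : nat) (C : 'M[R]_n) (A : {set 'I_n})
  : 'M[R]_#|A| :=
  \matrix_(i < #|A|, j < #|A|) C (enum_val i) (enum_val j).

(* D(C): feasible sets are the A with C[A] non-singular
   (C[set0] is the 0x0 matrix, whose determinant is 1, so it is non-singular) *)
Definition DC (n : nat) (C : 'M['F_2]_n) : {set {set 'I_n}} :=
  [set A : {set 'I_n} | \det (principal_submx C A) != 0].

Definition is_binary (E : finType) (F : {set {set E}}) : Prop :=
  exists (A : {set E}) (n : nat) (f : E -> 'I_n) (C : 'M['F_2]_n),
    [/\ bijective f, C^T = C &
        forall X : {set E}, (X \in twist F A) = (f @: X \in DC C)].

Definition width (E : finType) (F : {set {set E}}) : nat :=
  (\max_(X in F) #|X| - \big[minn/#|E|]_(X in F) #|X|)%N.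

Definition twist_poly (E : finType) (F : {set {set E}}) : {poly int} :=
  \sum_(A : {set E}) 'X^(width (twist F A)).

Definition has_gap (p : {poly int}) (i k : nat) : Prop :=
  [/\ (0 < i)%N, (0 < k)%N, p`_i.-1 * p`_(i + k) != 0 &
      forall j, (i <= j < i + k)%N -> p`_j = 0].

Definition interpolating (p : {poly int}) : Prop :=
  p != 0 /\ forall i k, ~ has_gap p i k.

(* p = p_e(z^2) + z p_o(z^2); even_poly p = p_e, odd_poly p = p_o *)
Definition even_interpolating (p : {poly int}) : Prop := interpolating (even_poly p).
Definition odd_interpolating (p : {poly int}) : Prop := interpolating (odd_poly p).

Definition even_polynomial (p : {poly int}) : Prop := forall i, odd i -> p`_i = 0.
Definition odd_polynomial (p : {poly int}) : Prop := forall i, ~~ odd i -> p`_i = 0.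

(* Main.v *)
Require Import Defs.
From mathcomp Require Import all_boot all_order all_algebra.
From mathcomp Require Import zify.
Set Implicit Arguments. Unset Strict Implicit. Unset Printing Implicit Defensive.
Import GRing.Theory.
Local Open Scope ring_scope.

(** Let [dist A] be the distance from A to the nearest feasible set. The width of D*A is
    |E| minus [codist A = dist A + dist (~: A)], and toggling one element changes the
    codistance by at most 2. If every single toggle in B increases [dist A] by one, then
    after pivoting on a feasible set nearest to A the representing matrix is alternating
    on the relevant elements, so the feasible sets there have even size and
    [dist (symdiff A B)] has the parity of [dist A + #|B|]. Along a descent that skips
    the value [codist X - 2] this yields a parity contradiction, so the widths attained
    admit no gap within a parity class. *)

(** * Algebra and cardinality of symmetric differences *)

Section SymDiff.
Variable T : finType.
Implicit Types (X Y Z : {set T}) (e : T).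

Lemma in_symdiff X Y e : (e \in symdiff X Y) = (e \in X) (+) (e \in Y).
Proof. by rewrite !inE; case: (e \in X); case: (e \in Y). Qed.

Lemma symdiffC X Y : symdiff X Y = symdiff Y X.
Proof. by apply/setP=> e; rewrite !in_symdiff addbC. Qed.

Lemma symdiffA X Y Z : symdiff X (symdiff Y Z) = symdiff (symdiff X Y) Z.
Proof. by apply/setP=> e; rewrite !in_symdiff addbA. Qed.

Lemma symdiffK X : involutive (symdiff X).
Proof. by move=> Y; apply/setP=> e; rewrite !in_symdiff addKb. Qed.

Lemma symdiff0 X : symdiff X set0 = X.
Proof. by apply/setP=> e; rewrite in_symdiff inE addbF. Qed.

Lemma symdiffCl X Y : symdiff (~: X) Y = ~: symdiff X Y.
Proof. by apply/setP=> e; rewrite in_setC !in_symdiff in_setC addNb. Qed.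

Lemma symdiffAC X Y Z : symdiff (symdiff X Y) Z = symdiff (symdiff X Z) Y.
Proof. by rewrite -!symdiffA (symdiffC Y). Qed.

Lemma symdiff_in e X : e \in X -> symdiff X [set e] = X :\ e.
Proof.
move=> eX; apply/setP=> u; rewrite in_symdiff !inE.
by case: eqP => [->|_]; rewrite ?eX ?addbF.
Qed.

Lemma symdiff_notin e X : e \notin X -> symdiff X [set e] = e |: X.
Proof.
move=> eX; apply/setP=> u; rewrite in_symdiff !inE.
by case: eqP => [->|_]; rewrite ?(negPf eX) ?addbF.
Qed.

Lemma symdiff2 (u v : T) X : u != v ->
  symdiff X [set u; v] = symdiff (symdiff X [set u]) [set v].
Proof.
move=> uv; apply/setP=> e; rewrite !in_symdiff !inE -addbA; congr (_ (+) _).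
by case: eqP => [->|//]; rewrite (negPf uv).
Qed.

Lemma card_symdiff1_in e X : e \in X -> #|symdiff X [set e]|.+1 = #|X|.
Proof. by move=> eX; rewrite symdiff_in // (cardsD1 e X) eX. Qed.

Lemma card_symdiff1_notin e X : e \notin X -> #|symdiff X [set e]| = #|X|.+1.
Proof. by move=> eX; rewrite symdiff_notin // cardsU1 eX. Qed.

Lemma odd_symdiff X Y : odd #|symdiff X Y| = odd #|X| (+) odd #|Y|.
Proof.
have D0 : (X :\: Y) :&: (Y :\: X) = set0.
  by apply/setP=> e; rewrite !inE; case: (e \in X); case: (e \in Y).
have := cardsID Y X; have := cardsID X Y; rewrite (setIC Y).
rewrite /symdiff cardsU D0 cards0 subn0 => <- <-; rewrite !oddD.
by do 3!case: (odd _).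
Qed.

End SymDiff.

(** Since [f] is bounded by [n], the default value of the big minimum never undercuts an attained
    value. *)
Lemma bigminn_spec (I : finType) (P : {set I}) (f : I -> nat) n :
  P != set0 -> (forall i, (f i <= n)%N) ->
  exists2 i, i \in P &
    \big[minn/n]_(j in P) f j = f i /\ forall j, j \in P -> (f i <= f j)%N.
Proof.
case/set0Pn=> i0 Pi0 fn.
case: (arg_minnP f Pi0) => i Pi fi; exists i => //; split=> //.
apply/eqP; rewrite eqn_leq; apply/andP; split.
  by rewrite -Order.NatOrder.leEnat -Order.NatOrder.minEnat Order.TotalTheory.bigmin_le_cond.
by elim/big_ind: _ => // x y; rewrite leq_min => -> ->.
Qed.

(** * Distance to the feasible sets and widths of twists *)

Section Distance.
Variables (E : finType) (F : {set {set E}}).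
Implicit Types (A B X Y Z S : {set E}) (e : E).

Definition dist A := \big[minn/#|E|]_(X in F) #|symdiff A X|.

Hypothesis F0 : F != set0.

Lemma dist_spec A : exists2 X, X \in F &
  dist A = #|symdiff A X| /\ forall Y, Y \in F -> (dist A <= #|symdiff A Y|)%N.
Proof.
have [X XF [dX minX]] := bigminn_spec F0 (fun X => max_card (mem (symdiff A X))).
by exists X => //; split=> // Y YF; rewrite /dist dX minX.
Qed.

Lemma dist_le A X : X \in F -> (dist A <= #|symdiff A X|)%N.
Proof. by have [Y _ [_ le]] := dist_spec A; apply: le. Qed.

Lemma dist_symdiff1 A e : (dist (symdiff A [set e]) <= (dist A).+1)%N.
Proof.
have [X XF [-> _]] := dist_spec A; apply: leq_trans (dist_le _ XF) _.
rewrite symdiffAC; have [eX|eX] := boolP (e \in symdiff A X).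
  by rewrite -(card_symdiff1_in eX) leqW.
by rewrite card_symdiff1_notin.
Qed.

(** Complementing [A] complements [symdiff A X], so the largest set of the twist has size
    [#|E| - dist (~: A)]; the smallest has size [dist A]. *)
Lemma width_twist A : (width (twist F A) + dist A + dist (~: A) = #|E|)%N.
Proof.
have tF: twist F A != set0.
  by have [X XF] := set0Pn _ F0; apply/set0Pn; exists (symdiff A X); apply: imset_f.
have [_ /imsetP[X XF ->] [dX minX]] :=
  bigminn_spec tF (fun Z => max_card (mem Z)).
have dA : \big[minn/#|E|]_(X in twist F A) #|X| = dist A.
  have [Y YF [dY minY]] := dist_spec A.
  apply/eqP; rewrite dX eqn_leq minY // andbT dY; apply: minX; exact: imset_f.
have [Y YF [dY minY]] := dist_spec (~: A).
have mA : \max_(X in twist F A) #|X| = (#|E| - dist (~: A))%N.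
  have cC Z : (#|symdiff (~: A) Z| = #|E| - #|symdiff A Z|)%N.
    by rewrite symdiffCl cardsCs setCK.
  have leE Z : (#|symdiff A Z| <= #|E|)%N := max_card _.
  apply/eqP; rewrite eqn_leq; apply/andP; split.
    apply/bigmax_leqP => _ /imsetP[Z ZF ->].
    by have := minY Z ZF; rewrite cC; have := leE Z; lia.
  rewrite dY cC subKn //; apply: leq_bigmax_cond; exact: imset_f.
rewrite /width dA mA.
have := dist_le (~: A) XF; rewrite symdiffCl [#|~: _|]cardsCs setCK.
have := dist_le A XF; have : (#|symdiff A X| <= #|E|)%N := max_card _.
lia.
Qed.

End Distance.

(* Principal pivoting on X makes the diagonal of the representing matrix zero on
   [symdiff X Y], so its principal submatrix there is alternating. *)
Definition locally_even (E : finType) (F : {set {set E}}) :=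
  forall X Y, X \in F -> Y \in F ->
    (forall e, e \in symdiff X Y -> symdiff X [set e] \notin F) ->
  ~~ odd #|symdiff X Y|.

(** * Parity of distances under symmetric exchange *)

Section Exchange.
Variables (E : finType) (F : {set {set E}}).
Hypotheses (dmF : is_delta_matroid F) (evF : locally_even F).
Implicit Types (A B X Y Z S : {set E}) (e : E).

Let F0 : F != set0 := proj1 dmF.

(** Among the feasible sets nearest to [A], take [Y] closest to [X]. An element of [symdiff X Y]
    outside [symdiff X A] lies in [symdiff A Y], and exchanging at it would bring [Y] closer to [X]
    but no farther from [A]. *)
Lemma nearest_between A X : X \in F -> exists2 Y, Y \in F &
  dist F A = #|symdiff A Y| /\ symdiff X Y \subset symdiff X A.
Proof.
move=> XF; have [Y0 Y0F [dY0 _]] := dist_spec F0 A.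
pose P Y := (Y \in F) && (dist F A == #|symdiff A Y|).
have PY0 : P Y0 by rewrite /P Y0F dY0 eqxx.
case: (arg_minnP (fun Y => #|symdiff X Y|) PY0) => Y /andP[YF /eqP dY] minY.
exists Y => //; split=> //; apply/subsetP=> u uXY; apply/negPn/negP=> uXA.
have uAY : u \in symdiff A Y.
  by move: uXY uXA; rewrite !in_symdiff; do 3!case: (_ \in _).
have uYX : u \in symdiff Y X by rewrite symdiffC.
have [v vYX] := (proj2 dmF) Y X u YF XF uYX.
have cA := card_symdiff1_in uAY; have cX := card_symdiff1_in uXY.
have [<-|uv] := eqVneq u v.
  rewrite setUid => /(dist_le F0 A); rewrite symdiffA; lia.
rewrite symdiff2 // => Y'F.
have vXY : v \in symdiff (symdiff X Y) [set u].
  by rewrite in_symdiff symdiffC vYX inE eq_sym (negPf uv).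
have cX' := card_symdiff1_in vXY.
have dA := dist_le F0 A Y'F.
have PY' : P (symdiff (symdiff Y [set u]) [set v]).
  rewrite /P Y'F eqn_leq dA /= dY !symdiffA.
  have [vA|vA] := boolP (v \in symdiff (symdiff A Y) [set u]).
    by rewrite -cA -(card_symdiff1_in vA) -addn2 leq_addr.
  by rewrite (card_symdiff1_notin vA) cA.
by have := minY _ PY'; rewrite !symdiffA -cX -cX' ltnNge leqnSn.
Qed.

(** Take [X] nearest to [A], and [Y] nearest to [symdiff A B] by [nearest_between]. For [e] in
    [symdiff X Y], a feasible [symdiff X [set e]] would be too close to [A] if [e] is in
    [symdiff A X], and too close to [symdiff A [set e]] otherwise. So [evF] applies. *)
Lemma odd_dist_symdiff A B S : B \subset S ->
    (forall e, e \in S -> dist F (symdiff A [set e]) = (dist F A).+1) ->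
  odd (dist F (symdiff A B)) = odd (dist F A) (+) odd #|B|.
Proof.
move=> BS dS; have [X XF [dX _]] := dist_spec F0 A.
have [Y YF [dY sXY]] := nearest_between (symdiff A B) XF.
have /negPf ev : ~~ odd #|symdiff X Y|.
  apply: evF => // e eXY; apply/negP=> XeF.
  have eXA : e \notin symdiff A X.
    apply/negP=> /card_symdiff1_in; have := dist_le F0 A XeF.
    rewrite symdiffA; lia.
  have eS : e \in S.
    apply: (subsetP BS); move: (subsetP sXY e eXY) eXA.
    by rewrite !in_symdiff; do 3!case: (_ \in _).
  have := dist_le F0 (symdiff A [set e]) XeF.
  rewrite (dS e eS) -symdiffA (symdiffC X) symdiffK; lia.
move: ev; rewrite dY dX !odd_symdiff.
by do 4!case: (odd _).
Qed.

Definition codist A := (dist F A + dist F (~: A))%N.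

(** A rise by 2 forces both distances to rise by 1; each then shifts parity by [#|B|], and the two
    shifts cancel. *)
Lemma odd_codist_symdiff A B :
    (forall e, e \in B -> codist (symdiff A [set e]) = (codist A).+2) ->
  odd (codist (symdiff A B)) = odd (codist A).
Proof.
move=> hB.
have dd e : e \in B -> dist F (symdiff A [set e]) = (dist F A).+1 /\
                       dist F (symdiff (~: A) [set e]) = (dist F (~: A)).+1.
  move=> /hB; rewrite /codist -symdiffCl.
  have := dist_symdiff1 F0 A e; have := dist_symdiff1 F0 (~: A) e; lia.
rewrite /codist -symdiffCl !oddD.
rewrite (odd_dist_symdiff (subxx B)) => [|e /dd[]//].
rewrite (odd_dist_symdiff (subxx B)) => [|e /dd[]//].
by do 3!case: (odd _).
Qed.

Lemma codist_symdiff1 A e : (codist (symdiff A [set e]) <= (codist A).+2)%N.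
Proof.
rewrite /codist -symdiffCl.
have := dist_symdiff1 F0 A e; have := dist_symdiff1 F0 (~: A) e; lia.
Qed.

(* Take B minimal in [symdiff X Y] with [codist (symdiff X B)] at least 3 below
   [codist X]. If the value 2 below is skipped, then every single step out of
   [symdiff X B] inside B goes up by exactly 2, so [codist X] has the parity of
   [codist X - 3]. *)
Lemma codist_step2 X Y : (codist Y + 3 <= codist X)%N ->
  exists Z, (codist Z + 2 = codist X)%N.
Proof.
move=> hXY.
have [/existsP[Z /eqP hZ]|] := boolP [exists Z, codist Z + 2 == codist X]%N.
  by exists Z.
rewrite negb_exists => /forallP hno; exfalso.
pose P B := (codist (symdiff X B) + 3 <= codist X)%N.
have PXY : P (symdiff X Y) by rewrite /P symdiffK.
case: (arg_minnP (fun B : {set E} => #|B|) PXY) => B PB minB.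
pose Z := symdiff X B; rewrite /P -/Z in PB.
have hB e : e \in B ->
    codist (symdiff Z [set e]) = (codist Z).+2 /\ (codist Z + 3 = codist X)%N.
  move=> eB; have up := codist_symdiff1 Z e.
  have ZE : symdiff Z [set e] = symdiff X (symdiff B [set e]) by rewrite symdiffA.
  have := hno (symdiff Z [set e]); have := card_symdiff1_in eB.
  have : ~~ P (symdiff B [set e]).
    by apply/negP=> /minB; have := card_symdiff1_in eB; lia.
  (* Minimality and [hno] leave [codist X <= codist (symdiff Z [set e]) + 1]; [PB] and [up] squeeze
     this into both equalities. *)
  by rewrite /P -ZE; lia.
have [B0|/set0Pn[e eB]] := eqVneq B set0.
  by move: PB; rewrite /Z B0 symdiff0; lia.
have [_ hZ] := hB e eB.
have := odd_codist_symdiff (fun e eB => proj1 (hB e eB)).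
have -> : symdiff Z B = X by apply/setP=> u; rewrite !in_symdiff addbK.
by rewrite -hZ oddD; case: (odd _).
Qed.

End Exchange.

(** * Principal minors as determinants of full size *)

Section RowMix.
Variables (K : fieldType) (n : nat).
Implicit Types (A : {set 'I_n}) (M N C : 'M[K]_n).

(** [row_mix A C 1%:M] stands in for C[A] at a size independent of [A], so that different [A] can be
    related by matrix products. *)
Definition row_mix A M N : 'M[K]_n := \matrix_(i, j) (if i \in A then M i j else N i j).

Lemma row_mixM A M N C : row_mix A M N *m C = row_mix A (M *m C) (N *m C).
Proof.
apply/matrixP=> i j; rewrite !mxE.
by case: ifP => iA; apply: eq_bigr => k _; rewrite mxE iA.
Qed.

(* Both sides have the same kernel, namely the vectors supported on A that C[A] kills. *)
Lemma det_row_mix1_eq0 C A :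
  (\det (row_mix A C 1%:M) == 0) = (\det (principal_submx C A) == 0).
Proof.
(* [det0P] speaks of row vectors killed on the left, hence the transposes. *)
rewrite -[in LHS]det_tr -[in RHS]det_tr; apply/det0P/det0P=> -[v v0 vC].
  have vA i : i \notin A -> v 0 i = 0.
    move=> iA; have /rowP/(_ i) := vC; rewrite !mxE (bigD1 i) //= big1 => [|j ji].
      by rewrite !mxE (negPf iA) eqxx mulr1 addr0.
    by rewrite !mxE (negPf iA) eq_sym (negPf ji) mulr0.
  exists (\row_k v 0 (enum_val k)).
    apply: contraNneq v0 => /rowP v0; apply/eqP/rowP=> i; rewrite mxE.
    have [iA|/vA//] := boolP (i \in A).
    by have := v0 (enum_rank_in iA i); rewrite !mxE enum_rankK_in.
  apply/rowP=> k; rewrite !mxE; have /rowP/(_ (enum_val k)) := vC.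
  rewrite !mxE => vk; apply: etrans vk.
  rewrite [RHS](bigID (mem A)) /= [X in _ + X]big1 ?addr0 => [|j jA].
    rewrite [RHS]big_enum_val /=; apply: eq_bigr => j _.
    by rewrite !mxE enum_valP.
  by rewrite vA // mul0r.
(* Extension of [v] by zero outside [A]. *)
pose w i := if pick [pred k : 'I_#|A| | enum_val k == i] is Some k then v 0 k else 0.
have wE k : w (enum_val k) = v 0 k.
  by rewrite /w; case: pickP => [l /eqP/enum_val_inj-> //|/(_ k)]; rewrite /= eqxx.
have wA i : i \notin A -> w i = 0.
  by rewrite /w; case: pickP => // k /eqP <-; rewrite enum_valP.
exists (\row_i w i).
  apply: contraNneq v0 => /rowP w0; apply/eqP/rowP=> k.
  by have := w0 (enum_val k); rewrite !mxE wE.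
apply/rowP=> i; rewrite !mxE; have [iA|iA] := boolP (i \in A).
  have /rowP/(_ (enum_rank_in iA i)) := vC; rewrite !mxE => vk; apply: etrans vk.
  rewrite [LHS](bigID (mem A)) /= [X in _ + X]big1 ?addr0 => [|j jA].
    rewrite [LHS]big_enum_val /=; apply: eq_bigr => j _.
    by rewrite !mxE iA wE enum_rankK_in.
  by rewrite mxE wA // mul0r.
rewrite big1 // => j _; rewrite !mxE (negPf iA).
by case: eqP => [<-|_]; rewrite ?mulr0 // wA // mul0r.
Qed.

End RowMix.

(* Lift C to an antisymmetric integer matrix K; then det K = (-1)^m det K. *)
Lemma det_alternating_F2 m (C : 'M['F_2]_m) :
  C^T = C -> (forall i, C i i = 0) -> odd m -> \det C = 0.
Proof.
move=> symC diagC odd_m.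
pose K : 'M[int]_m := \matrix_(i, j)
  if (i < j)%N then (C i j : nat)%:Z else if (j < i)%N then - (C i j : nat)%:Z else 0.
have -> : C = map_mx intr K.
  apply/matrixP=> i j; rewrite !mxE; case: ltngtP => [_|_|/ord_inj->].
  - by rewrite -[LHS]natr_Zp.
  - by rewrite rmorphN /= -[LHS]natr_Zp; apply/val_inj; case: (C i j) => [[|[|]]].
  - by rewrite diagC.
have KT : K^T = - K.
  apply/matrixP=> i j; rewrite !mxE -[in C j i]symC mxE.
  by case: ltngtP => _; rewrite ?opprK ?oppr0.
rewrite det_map_mx /=; have detK : \det K = - \det K.
  by rewrite -[in LHS]det_tr KT -scaleN1r detZ -signr_odd odd_m mulN1r.
(* Over the integers d = -d forces d = 0; over ['F_2] it would say nothing. *)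
have -> : \det K = 0 by move: (\det K) detK => d; lia.
exact: rmorph0.
Qed.

(** * Principal pivoting over GF(2) *)

Section Pivot.
Variables (n : nat) (C : 'M['F_2]_n).
Hypothesis symC : C^T = C.

Lemma addrr_F2 m p (M : 'M['F_2]_(m, p)) : M + M = 0.
Proof.
by apply/matrixP=> i j; rewrite !mxE; apply/val_inj; case: (M i j) => [[|[|]]].
Qed.

(** For [D] = N M^-1, symmetry amounts to N^T M = M^T N. *)
Lemma pivot_symmetric X : row_mix X C 1%:M \in unitmx ->
  let D := row_mix X 1%:M C *m invmx (row_mix X C 1%:M) in D^T = D.
Proof.
set M := row_mix X C _; set N := row_mix X _ C => uM D.
have CT i j : C j i = C i j by rewrite -[in LHS]symC mxE.
have MN i j : (M^T *m N) i j =
    (if j \in X then C i j else 0) + (if i \in X then 0 else C i j).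
  transitivity (\sum_k ((if k == j then if k \in X then C i k else 0 else 0) +
                        (if k == i then if k \in X then 0 else C k j else 0))).
    rewrite mxE; apply: eq_bigr => k _; rewrite !mxE.
    case: (k \in X).
      by rewrite (CT i k); case: (k == j); case: (k == i); rewrite ?mulr1 ?mulr0 ?addr0.
    by case: (k == i); case: (k == j); rewrite ?mul1r ?mul0r ?add0r.
  by rewrite big_split /= -!big_mkcond !big_pred1_eq.
have symMN : N^T *m M = M^T *m N.
  rewrite -[LHS]trmxK trmx_mul trmxK; apply/matrixP=> i j; rewrite mxE !MN CT.
  (* When exactly one of [i], [j] is in [X], one side is 0 and the other is twice an entry of [C]:
     characteristic 2 is used here. *)
  move: (addrr_F2 C) => /matrixP/(_ i j); rewrite !mxE.
  by case: (i \in X); case: (j \in X); rewrite ?addr0 ?add0r.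
by rewrite /D trmx_mul trmx_inv -[N^T](mulmxK uM) symMN !mulmxA mulVmx ?mul1mx ?unitmx_tr.
Qed.

(** Multiplying [row_mix Y D 1%:M] on the right by the invertible [row_mix X C 1%:M] gives
    [row_mix (symdiff X Y) C 1%:M]. *)
Lemma DC_pivot X : X \in DC C -> exists D : 'M['F_2]_n,
  D^T = D /\ forall Y, (symdiff X Y \in DC C) = (Y \in DC D).
Proof.
rewrite inE -det_row_mix1_eq0 => dX.
have uM : row_mix X C 1%:M \in unitmx by rewrite unitmxE unitfE.
exists (row_mix X 1%:M C *m invmx (row_mix X C 1%:M)).
split=> [|Y]; first exact: pivot_symmetric.
rewrite !inE -!det_row_mix1_eq0.
rewrite -[X in row_mix Y _ X](mulmxV uM) -row_mixM det_mulmx.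
rewrite mulf_eq0 negb_or det_inv invr_eq0 dX andbT; congr (\det _ != 0).
apply/matrixP=> i j; rewrite !mxE in_symdiff.
by case: (i \in X); case: (i \in Y).
Qed.

End Pivot.

(** * Local evenness of binary delta-matroids *)

Lemma set1_in_DC n (C : 'M['F_2]_n) i : ([set i] \in DC C) = (C i i != 0).
Proof.
rewrite inE.
have : forall k l, principal_submx C [set i] k l = C i i.
  by move=> k l; rewrite mxE !(set1P (enum_valP _)).
(* Generalizing the submatrix lets [cards1] rewrite its dimension. *)
by move: (principal_submx _ _); rewrite cards1 => P PC; rewrite det_mx11 PC.
Qed.

Lemma DC_locally_even n (C : 'M['F_2]_n) : C^T = C -> locally_even (DC C).
Proof.
move=> symC X Y XC; have [D [symD DE]] := DC_pivot symC XC.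
rewrite -[Y in Y \in _](symdiffK X) DE inE => dY eXY.
apply: contraNN dY => odd_XY; apply/eqP/det_alternating_F2 => //.
  by apply/matrixP=> k l; rewrite !mxE -[in LHS]symD mxE.
move=> k; rewrite mxE; have := eXY _ (enum_valP k).
by rewrite DE set1_in_DC negbK => /eqP.
Qed.

Lemma imset_symdiff (T U : finType) (f : T -> U) (X Y : {set T}) :
  injective f -> f @: symdiff X Y = symdiff (f @: X) (f @: Y).
Proof.
move=> inj_f.
have imsetD (A B : {set T}) : f @: (A :\: B) = f @: A :\: f @: B.
  apply/setP=> u; apply/imsetP/setDP => [[x /setDP[xA xB] ->]|[/imsetP[x xA ->]]].
    by rewrite !mem_imset.
  by rewrite mem_imset // => xB; exists x; rewrite // inE xB.
by rewrite [LHS]imsetU !imsetD.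
Qed.

(** Local evenness survives twisting and relabelling, since the twist by [A] cancels in symmetric
    differences of feasible sets. *)
Lemma binary_locally_even (E : finType) (F : {set {set E}}) :
  is_binary F -> locally_even F.
Proof.
case=> A [n [f [C [bij_f symC FC]]]]; have inj_f := bij_inj bij_f.
have FE X : (X \in F) = (f @: symdiff A X \in DC C).
  rewrite -FC; apply/idP/imsetP => [XF|[Y YF]]; first by exists X.
  by move=> /(congr1 (symdiff A)); rewrite !symdiffK => ->.
move=> X Y; rewrite !FE => XF YF eXY.
have XY : f @: symdiff X Y = symdiff (f @: symdiff A X) (f @: symdiff A Y).
  by rewrite -imset_symdiff // (symdiffC A X) -symdiffA symdiffK.
rewrite -(card_imset _ inj_f) XY; apply: DC_locally_even symC _ _ XF YF _.
rewrite -XY => _ /imsetP[e eE ->]; have := eXY e eE.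
by rewrite FE symdiffA imset_symdiff // imset_set1.
Qed.

(** * From attained widths to gaps in coefficients *)

Lemma coef_twist_poly (E : finType) (F : {set {set E}}) i :
  (twist_poly F)`_i != 0 <-> exists A, width (twist F A) = i.
Proof.
(* Coefficients count twists, so nothing cancels. *)
have -> : (twist_poly F)`_i = (#|[set A | width (twist F A) == i]|)%:R.
  rewrite coef_sum -sum1_card natr_sum [RHS]big_mkcond /=.
  by apply: eq_bigr => A _; rewrite coefXn inE eq_sym; case: eqP.
rewrite Num.Theory.pnatr_eq0 cards_eq0; split=> [/set0Pn[A]|[A wA]].
  by rewrite inE => /eqP; exists A.
by apply/set0Pn; exists A; rewrite inE wA.
Qed.

(** Width is [#|E|] minus [codist], so the smaller width [i] has the larger codistance, and lowering
    that by 2 gives width [i + 2]. *)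
Lemma twist_poly_step2 (E : finType) (F : {set {set E}}) i j :
    is_delta_matroid F -> is_binary F -> (i + 3 <= j)%N ->
  (twist_poly F)`_i != 0 -> (twist_poly F)`_j != 0 -> (twist_poly F)`_(i + 2) != 0.
Proof.
move=> dmF binF ij /coef_twist_poly[X wX] /coef_twist_poly[Y wY].
have F0 := proj1 dmF; have wXE := width_twist F0 X; have wYE := width_twist F0 Y.
have hXY : (codist F Y + 3 <= codist F X)%N by rewrite /codist; lia.
have [Z hZ] := codist_step2 dmF (binary_locally_even binF) hXY.
apply/coef_twist_poly; exists Z; have := width_twist F0 Z.
by move: hZ; rewrite /codist; lia.
Qed.

(* For b = false, true the polynomial q is the even, odd part of the twist polynomial. *)
Lemma parity_part_no_gap (E : finType) (F : {set {set E}}) (q : {poly int}) (b : bool) :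
    is_delta_matroid F -> is_binary F ->
    (forall i, q`_i = (twist_poly F)`_(b + i.*2)) ->
  forall i k, ~ has_gap q i k.
Proof.
move=> dmF binF qE [|i] [|k] [//= _ _]; rewrite mulf_eq0 negb_or !qE.
move=> /andP[ci cik] /(_ i.+1); rewrite qE leqnn /= => gap.
(* The nonzero ends of the gap are at least 4 apart in the twist polynomial, so the first
   coefficient of the gap cannot vanish. *)
have ij : (b + i.*2 + 3 <= b + (i.+1 + k.+1).*2)%N by lia.
have := twist_poly_step2 dmF binF ij ci cik.
by rewrite -addnA addn2 -doubleS gap ?eqxx // addnS ltnS leq_addr.
Qed.

Theorem theorem1 (E : finType) (F : {set {set E}}) :
  is_delta_matroid F -> is_binary F ->
  even_polynomial (twist_poly F) \/ odd_polynomial (twist_poly F) \/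
  (even_interpolating (twist_poly F) /\ odd_interpolating (twist_poly F)).
Proof.
move=> dmF binF; set p := twist_poly F.
have evE i : (even_poly p)`_i = p`_(false + i.*2) by rewrite coef_even_poly.
have odE i : (odd_poly p)`_i = p`_(true + i.*2) by rewrite coef_odd_poly.
have [od0|od0] := eqVneq (odd_poly p) 0.
  left=> i odd_i; rewrite -(odd_double_half i) odd_i.
  by rewrite -odE od0 coef0.
have [ev0|ev0] := eqVneq (even_poly p) 0.
  right; left=> i even_i; rewrite -(odd_double_half i) (negPf even_i).
  by rewrite -evE ev0 coef0.
right; right; split; split=> //; first exact: parity_part_no_gap evE.
exact: parity_part_no_gap odE.
Qed.
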